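(* Let $G=(V,E)$ be a connected locally finite graph, let $\Gamma$ be a closed subgroup of $\mathrm{Aut}(G)$ that acts transitively on $G$, and let $\mathbf{w}$ be the relative weight function induced by $\Gamma$. Then the spectral radius $\rho^{(\mathbf{w})}(G)$ of the $\sqrt{\mathbf{w}}$-biased random walk $X^{(\mathbf{w})}$ on $G$ satisfies $$\frac12\,\Phi^{\mathbf{w}}_E(G,c)^2\le 1-\sqrt{1-\Phi^{\mathbf{w}}_E(G,c)^2}\le 1-\rho^{(\mathbf{w})}(G)\le \Phi^{\mathbf{w}}_E(G,c).$$ In particular, $\rho^{(\mathbf{w})}(G)=1$ if and only if $G$ is $\mathbf{w}$-amenable.
   Context: $\mathrm{Aut}(G)$ carries the topology of pointwise convergence. For $x\in V$, $\Gamma_x$ is the stabilizer of $x$ in $\Gamma$. The relative weight function is $\mathbf{w}^y(x):=|\Gamma_x y|/|\Gamma_y x|$ for $x,y\in V$. Fix a reference vertex $o\in V$ and write $\mathbf{w}^o(A)=\sum_{x\in A}\mathbf{w}^o(x)$ for $A\subseteq V$; the quantities below do not depend on $o$. $G$ is $\mathbf{w}$-amenable if $\inf\{\mathbf{w}^o(\partial_V F)/\mathbf{w}^o(F): F\subseteq V,\ 0<|F|<\infty\}=0$, where $\partial_V F$ is the external vertex boundary of $F$. Let $D^{\mathbf{w}}:=\sum_{z\sim o}\sqrt{\mathbf{w}^o(z)}$. The $\sqrt{\mathbf{w}}$-biased random walk $X^{(\mathbf{w})}$ is the Markov chain on $V$ with transition probabilities $p^{(\mathbf{w})}(x,y)=\sqrt{\mathbf{w}^x(y)}/D^{\mathbf{w}}$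 for $x\sim y$. Its spectral radius is $\rho^{(\mathbf{w})}(G)=\limsup_{n\to\infty}p^{(\mathbf{w})}_{2n}(x,x)^{1/(2n)}$, where $p^{(\mathbf{w})}_n(x,y)$ is the $n$-step transition probability (independent of $x\in V$). The conductances are $c(x,y):=\mathbf{w}^o(x)p^{(\mathbf{w})}(x,y)=\sqrt{\mathbf{w}^o(x)\mathbf{w}^o(y)}/D^{\mathbf{w}}$ for edges $(x,y)$. For a set $E'$ of edges $c(E')=\sum_{e\in E'}c(e)$, and $$\Phi^{\mathbf{w}}_E(G,c):=\inf\Big\{\frac{c(\partial_E F)}{\mathbf{w}^o(F)}:\ \emptyset\ne F\subseteq V,\ \mathbf{w}^o(F)<\infty\Big\},$$ where $\partial_E F$ is the set of edges with exactly one endpoint in $F$. *)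

(* Defs.v *)
From HB Require Import structures.
From mathcomp Require Import all_boot all_order all_algebra finmap.
From mathcomp Require Import all_classical all_reals all_analysis.
Import Order.TTheory GRing.Theory Num.Theory.
Import numFieldNormedType.Exports.

Set Implicit Arguments.
Unset Strict Implicit.
Unset Printing Implicit Defensive.

Local Open Scope classical_set_scope.
Local Open Scope ring_scope.

Section Graph.
Variables (V : choiceType) (adj : rel V).

Definition simple_graph : Prop := symmetric adj /\ irreflexive adj.

Definition connected_graph : Prop :=
  forall x y : V, exists2 s : seq V, path adj x s & last x s = y.

Definition locally_finite_graph : Prop :=
  forall x : V, finite_set [set y | adj x y].

Definition graph_aut : set (V -> V) :=
  [set g | bijective g /\ forall x y, adj (g x) (g y) = adj x y].

Definition aut_subgroup (Gamma : set (V -> V)) : Prop :=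
  [/\ Gamma `<=` graph_aut,
      Gamma id,
      forall g h, Gamma g -> Gamma h -> Gamma (g \o h) &
      forall g h, Gamma g -> cancel g h -> cancel h g -> Gamma h].

(* Closedness is relative to Aut(G), whose topology of pointwise convergence is
   the one induced by the product topology on V -> V, with V discrete. *)
Definition closed_in_aut (Gamma : set (V -> V)) : Prop :=
  exists2 C : set {ptws V -> discrete_topology V},
    closed C & Gamma = C `&` graph_aut.

End Graph.

Section Weights.
Variables (R : realType) (V : choiceType) (adj : rel V) (Gamma : set (V -> V)).

Definition acts_transitively : Prop :=
  forall x y : V, exists2 g, Gamma g & g x = y.

Definition stabilizer (x : V) : set (V -> V) := [set g | Gamma g /\ g x = x].

Definition stab_orbit (x y : V) : set V := [set g y | g in stabilizer x].

(* [relw y x] is w^y(x).  [fset_set] sends infinite sets to the empty set, but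
   the orbits here are finite: Gamma_x preserves the distance to x, and the
   graph is connected and locally finite. *)
Definition relw (y x : V) : R :=
  #|` fset_set (stab_orbit x y)|%:R / #|` fset_set (stab_orbit y x)|%:R.

Definition set_weight (o : V) (A : set V) : \bar R :=
  \esum_(x in A) (relw o x)%:E.

Definition outer_boundary (F : set V) : set V :=
  [set y | ~ F y /\ exists2 x, F x & adj x y].

Definition w_amenable (o : V) : Prop :=
  ereal_inf [set (set_weight o (outer_boundary F) / set_weight o F)%E
            | F in [set F | finite_set F /\ F !=set0]] = 0%E.

Definition walk_norm (o : V) : R :=
  \sum_(z \in [set z | adj o z]) Num.sqrt (relw o z).

Definition walk_step (o x y : V) : R :=
  if adj x y then Num.sqrt (relw x y) / walk_norm o else 0.

(* The sum over V has finite support, included in the neighbours of x. *)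
Fixpoint walk_nstep (o : V) (n : nat) (x y : V) : R :=
  if n is n'.+1 then
    \sum_(z \in [set: V]) walk_step o x z * walk_nstep o n' z y
  else (x == y)%:R.

Definition spectral_radius (o x : V) : R :=
  limn_sup (fun n : nat => walk_nstep o (2 * n)%N x x `^ (2 * n)%N%:R^-1).

Definition conductance (o x y : V) : R := relw o x * walk_step o x y.

(* Each unoriented edge with exactly one endpoint in F is represented once, by
   its orientation pointing out of F. *)
Definition edge_boundary (F : set V) : set (V * V) :=
  [set xy | [/\ adj xy.1 xy.2, F xy.1 & ~ F xy.2]].

Definition boundary_conductance (o : V) (F : set V) : \bar R :=
  \esum_(xy in edge_boundary F) (conductance o xy.1 xy.2)%:E.

(* The infimum lies in [0, 1], so that taking [fine] loses nothing: the total
   conductance of the edges at x is w^o(x). *)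
Definition edge_expansion (o : V) : R :=
  fine (ereal_inf [set (boundary_conductance o F / set_weight o F)%E
                  | F in [set F | F !=set0 /\ (set_weight o F < +oo)%E]]).

End Weights.

(* Main.v *)
(* Write w for the weight based at o and h = sqrt w. By the cocycle identity
   w^x(y) w^y(z) = w^x(z), conjugation by h turns the walk into the symmetric
   kernel a(x,y) = 1_{x ~ y} / D, for which h is harmonic, and
   c(x,y) = h(x) a(x,y) h(y). Since p_2n(x,x) is the value at (x,x) of the 2n-th
   power of a cut down to any large enough finite set of vertices, only finite
   symmetric kernels need spectral estimates.

   Upper bound on rho: Cheeger's inequality, i.e. the coarea formula for f^2
   followed by Cauchy-Schwarz, bounds the quadratic form of a by
   sqrt (1 - Phi^2), hence by polarization its operator norm, hence p_2n(x,x).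
   Lower bound on rho: for finite F, the norms of a_F^n h_F are log-convex in n,
   so they grow at least like the Rayleigh quotient of h_F, which is
   1 - c(dF) / w(F), while |a_F^n h_F|^2 <= |F| w(F) p_2n(x,x).
   Infinite sets of finite weight do not lower the infimum defining Phi.
   Finally, c(dF) and the weight of the outer vertex boundary of F are within
   the factor D^2 of each other, so Phi = 0 exactly when G is w-amenable. *)
Require Import Defs.
From HB Require Import structures.
From mathcomp Require Import all_boot all_order all_algebra finmap.
From mathcomp Require Import all_classical all_reals all_analysis.
From mathcomp Require Import zify lra.
Import Order.TTheory GRing.Theory Num.Theory.
Import numFieldNormedType.Exports.
Local Open Scope classical_set_scope.
Local Open Scope ring_scope.

Set Implicit Arguments.
Unset Strict Implicit.
Unset Printing Implicit Defensive.

(** * Spectral estimates for finite symmetric kernels *)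

Section FiniteKernel.
Variables (R : realType) (T : finType).
Implicit Types (f g : T -> R).

Definition dot f g : R := \sum_x f x * g x.

Lemma dotC f g : dot f g = dot g f.
Proof. by apply: eq_bigr => x _; rewrite mulrC. Qed.

Lemma dot_ge0 f : 0 <= dot f f.
Proof. by apply: sumr_ge0 => x _; rewrite -expr2 sqr_ge0. Qed.

(** By Lagrange's identity, the double sum of squares below is twice the gap in Cauchy-Schwarz. *)
Lemma dot_sqr_le f g : dot f g ^+ 2 <= dot f f * dot g g.
Proof.
have : 0 <= \sum_x \sum_y (f x * g y - f y * g x) ^+ 2.
  by apply: sumr_ge0 => x _; apply: sumr_ge0 => y _; exact: sqr_ge0.
under eq_bigr => x _.
  under eq_bigr => y _.
    have -> : (f x * g y - f y * g x) ^+ 2 =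
      (f x * f x) * (g y * g y) + (g x * g x) * (f y * f y)
      - 2 * ((f x * g x) * (f y * g y)) by lra.
    over.
  rewrite sumrB big_split /= -mulr_sumr -!mulr_sumr.
  over.
rewrite sumrB big_split /= -mulr_sumr -!mulr_suml -/(dot f f) -/(dot g g) -/(dot f g).
by move=> h; rewrite expr2; lra.
Qed.

Variable q : T -> T -> R.
Hypothesis q_sym : forall x y, q x y = q y x.

Definition kapp f : T -> R := fun x => \sum_y q x y * f y.

(** The entry [(x, y)] of the matrix power [q^n], read off its column at [y]. *)
Definition kpow n x y : R := iter n kapp (fun z => (z == y)%:R) x.

Lemma kapp_self_adj f g : dot f (kapp g) = dot (kapp f) g.
Proof.
rewrite /dot /kapp.
under eq_bigr do rewrite mulr_sumr.
rewrite exchange_big /=; apply: eq_bigr => y _.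
rewrite mulr_suml; apply: eq_bigr => x _.
by rewrite (q_sym y x); lra.
Qed.

Lemma dot_iter n m f g :
  dot (iter n kapp f) (iter m kapp g) = dot f (iter (n + m) kapp g).
Proof.
elim: n m => [//|n IH] m.
by rewrite iterS -kapp_self_adj (IH m.+1) addnS addSn.
Qed.

Lemma dot_delta x f : dot (fun z => (z == x)%:R) f = f x.
Proof.
rewrite /dot (bigD1 x) //= eqxx mul1r big1 ?addr0 // => y /negPf ->.
by rewrite mul0r.
Qed.

(** Self-adjointness moves half of the [2n] factors to the other side, so a diagonal entry of an
    even power is a squared norm. *)
Lemma kpow_double n x :
  kpow (2 * n) x x = dot (iter n kapp (fun z => (z == x)%:R))
                         (iter n kapp (fun z => (z == x)%:R)).
Proof. by rewrite dot_iter addnn -mul2n dot_delta. Qed.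

Lemma iter_kapp_expand n f y :
  iter n kapp f y = \sum_x f x * kpow n y x.
Proof.
rewrite /kpow; elim: n y => [|n IH] y /=.
  rewrite (bigD1 y) //= eqxx mulr1 big1 ?addr0 // => x.
  by rewrite eq_sym => /negPf ->; rewrite mulr0.
transitivity (\sum_z \sum_x q y z * (f x * kpow n z x)).
  by apply: eq_bigr => z _; rewrite IH mulr_sumr.
rewrite exchange_big /=; apply: eq_bigr => x _.
by rewrite [RHS]mulr_sumr; apply: eq_bigr => z _; rewrite mulrCA.
Qed.

Lemma dot_comb f g (e : R) :
  dot (fun x => f x + e * g x) (fun x => f x + e * g x) =
  dot f f + 2 * (e * dot f g) + e ^+ 2 * dot g g.
Proof.
by rewrite /dot !mulr_sumr -!big_split /=; apply: eq_bigr => x _; lra.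
Qed.

Lemma dot_kapp_comb f g (e : R) :
  dot (fun x => f x + e * g x) (kapp (fun x => f x + e * g x)) =
  dot f (kapp f) + 2 * (e * dot (kapp f) g) + e ^+ 2 * dot g (kapp g).
Proof.
have -> : kapp (fun x => f x + e * g x) = fun x => kapp f x + e * kapp g x.
  apply/funext => x; rewrite /kapp mulr_sumr -big_split /=.
  by apply: eq_bigr => y _; lra.
rewrite [X in _ = _ + X + _](_ : _ = e * dot g (kapp f) + e * dot f (kapp g)).
  rewrite /dot !mulr_sumr -!big_split /=.
  by apply: eq_bigr => x _; lra.
by rewrite (kapp_self_adj f g) (dotC g); lra.
Qed.

(** Polarization: the form bounds at [f + g] and [f - g] give [4 <qf, g> <= 2 s (|f|^2 + |g|^2)],
    and [g = q f / s] balances the two sides. *)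
Lemma kapp_norm_le (s : R) f : 0 < s ->
  (forall g, `|dot g (kapp g)| <= s * dot g g) ->
  dot (kapp f) (kapp f) <= s ^+ 2 * dot f f.
Proof.
move=> s0 qs.
pose g : T -> R := fun x => s^-1 * kapp f x.
have := qs (fun x => f x + 1 * g x); have := qs (fun x => f x + (-1) * g x).
rewrite !dot_kapp_comb !dot_comb => /ler_normlP[+ _] /ler_normlP[_].
have -> : dot (kapp f) g = s^-1 * dot (kapp f) (kapp f).
  by rewrite /dot mulr_sumr; apply: eq_bigr => x _; rewrite /g; lra.
have -> : dot g g = s^-2 * dot (kapp f) (kapp f).
  rewrite /dot mulr_sumr; apply: eq_bigr => x _; rewrite /g.
  by rewrite expr2 invfM; lra.
set K := dot (kapp f) (kapp f) => h1 h2.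
have h3 : 4 * (s^-1 * K) <= s * (2 * dot f f) + s * (2 * (s ^- 2 * K)) by lra.
have sn0 : s != 0 by rewrite gt_eqF.
have h4 : s * (s ^- 2 * K) = s^-1 * K by rewrite expr2 invfM !mulrA mulfV // mul1r.
have h5 : s^-1 * K <= s * dot f f by rewrite (mulrCA s 2 (_ * K)) h4 in h3; lra.
by rewrite ler_pdivrMl // in h5; rewrite expr2 -mulrA.
Qed.

Lemma kpow_double_le (s : R) n x : 0 < s ->
  (forall g, `|dot g (kapp g)| <= s * dot g g) ->
  kpow (2 * n) x x <= s ^+ (2 * n).
Proof.
move=> s0 qs; rewrite kpow_double; elim: n => [|n IH].
  by rewrite dot_delta /= eqxx.
apply: (le_trans (kapp_norm_le _ s0 qs)).
by rewrite mulnS exprD ler_wpM2l // sqr_ge0.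
Qed.

(* Cauchy-Schwarz makes the squared norms [|q^n u|^2] log-convex in [n]. *)
Lemma iter_norm_ge u (l : R) n : 0 <= l -> 0 < dot u u ->
  dot u (kapp u) = l * dot u u ->
  l ^+ (2 * n) * dot u u <= dot (iter n kapp u) (iter n kapp u).
Proof.
rewrite le_eqVlt => /predU1P[<- u0 _|l0 u0 ul].
  case: n => [|n]; first by rewrite mul1r.
  by rewrite mulnS exprD expr2 !mul0r dot_ge0.
set b := fun n => dot (iter n kapp u) (iter n kapp u).
suff h k : 0 < b k /\ l ^+ 2 * b k <= b k.+1.
  elim: n => [|n IH]; first by rewrite mul1r.
  rewrite mulnS exprD -mulrA; apply: le_trans (h n).2.
  by rewrite ler_wpM2l // sqr_ge0.
elim: k => [|k [bk0 IH]].
  split => //; have := dot_sqr_le u (kapp u).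
  rewrite ul exprMn expr2 (expr2 (dot u u)) mulrCA -/(b 1%N).
  by rewrite ler_pM2l // /b /= expr2 -mulrA.
have bk1 : 0 < b k.+1 by apply: lt_le_trans IH; rewrite mulr_gt0 // exprn_gt0.
split => //.
have := dot_sqr_le (iter k kapp u) (iter k.+2 kapp u).
rewrite dot_iter addnS -addSn -dot_iter -/(b k.+1) -/(b k) -/(b k.+2) => h.
rewrite -(ler_pM2l bk0); apply: le_trans h.
by rewrite mulrCA mulrA expr2 [leRHS]expr2 ler_pM2r.
Qed.

(** Expanding [q^n u] in the columns of [q^n], Cauchy-Schwarz over the [#|T|] columns bounds its
    squared norm by [#|T|] times the sum of [u(x)^2 |q^n delta_x|^2], and [|q^n delta_x|^2] is
    [kpow (2 * n) x x]. *)
Lemma kpow_double_ge u (l M : R) n : 0 <= l -> 0 < dot u u ->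
  dot u (kapp u) = l * dot u u ->
  (forall x, kpow (2 * n) x x <= M) -> l ^+ (2 * n) <= #|T|%:R * M.
Proof.
move=> l0 u0 ul hM; have := iter_norm_ge n l0 u0 ul.
suff h : dot (iter n kapp u) (iter n kapp u) <= #|T|%:R * M * dot u u.
  by move=> /le_trans /(_ h); rewrite ler_pM2r.
apply: (@le_trans _ _ (\sum_y #|T|%:R * \sum_x (u x * kpow n y x) ^+ 2)).
  apply: ler_sum => y _; rewrite iter_kapp_expand -expr2.
  have := dot_sqr_le (fun=> 1) (fun x => u x * kpow n y x).
  rewrite /dot; under eq_bigr do rewrite mul1r.
  under [X in _ <= X * _]eq_bigr do rewrite mulr1.
  by rewrite sumr_const.
rewrite -mulr_sumr exchange_big /= -mulrA ler_wpM2l // mulr_sumr.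
apply: ler_sum => x _.
under eq_bigr do rewrite exprMn.
rewrite -mulr_sumr -expr2 mulrC ler_wpM2r ?sqr_ge0 //.
apply: le_trans (hM x).
by rewrite kpow_double.
Qed.

End FiniteKernel.

(** * Cheeger's inequality on a finite network, possibly with killing *)

Section Cheeger.
Variables (R : realType) (T : finType) (c : T -> T -> R) (pi : T -> R) (Phi : R).
Hypothesis c_sym : forall x y, c x y = c y x.
Hypothesis c_ge0 : forall x y, 0 <= c x y.
Hypothesis c_pi : forall x, \sum_y c x y <= pi x.
Hypothesis expansion : forall F : {set T},
  \sum_(x in F) \sum_(y in F) c x y <= (1 - Phi) * \sum_(x in F) pi x.

(** Layer-cake induction on the size of the support [F] of [g]: lowering [g] on [F] by its minimum
    there shrinks the support and changes both sides by that minimum times the two sides of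
    [expansion] at [F]. *)
Lemma coarea (g : T -> R) : (forall x, 0 <= g x) ->
  \sum_x \sum_y c x y * Num.min (g x) (g y) <= (1 - Phi) * \sum_x pi x * g x.
Proof.
have [n] := ubnP #|[set x | g x != 0%R]%SET|.
elim: n g => // n IH g hn g0.
set F := [set x | g x != 0]%SET in hn.
have [F0|[x0 x0F]] := set_0Vmem F.
  have gz x : g x = 0.
    apply/eqP; apply: contraT => gx.
    have : x \in F by rewrite inE.
    by rewrite F0 inE.
  rewrite big1 => [|x _]; last by rewrite big1 // => y _; rewrite !gz minxx mulr0.
  by rewrite big1 ?mulr0 // => x _; rewrite gz mulr0.
case: (@Order.TotalTheory.arg_minP _ _ _ x0 (mem F) g x0F) => m mF' mmin.
have {mF'} mF : m \in F by [].
have {}mmin x : x \in F -> g m <= g x by move=> xF; exact: mmin.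
pose g' : T -> R := fun x => g x - g m * (x \in F)%:R.
have gF x : x \notin F -> g x = 0 by rewrite inE negbK => /eqP.
have g'0 x : 0 <= g' x.
  rewrite /g'; case: (boolP (x \in F)) => xF; last by rewrite mulr0 subr0.
  by rewrite mulr1 subr_ge0 mmin.
have hn' : (#|[set x | g' x != 0%R]%SET| < n)%N.
  rewrite ltnS in hn; apply: leq_trans hn; apply: proper_card.
  apply/properP; split.
    apply/fintype.subsetP => x; rewrite inE => g'x; apply: contraNT g'x => xF.
    by rewrite /g' gF // (negPf xF) mulr0 subr0.
  by exists m => //; rewrite inE /g' mF mulr1 subrr eqxx.
have := IH g' hn' g'0.
have -> : \sum_x pi x * g' x = \sum_x pi x * g x - g m * \sum_(x in F) pi x.
  rewrite (big_mkcond (fun x => x \in F)) mulr_sumr -sumrB; apply: eq_bigr => x _.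
  by rewrite /g' /=; case: (x \in F); rewrite ?mulr1n ?mulr0n; lra.
have -> : \sum_x \sum_y c x y * Num.min (g' x) (g' y) =
    \sum_x \sum_y c x y * Num.min (g x) (g y)
    - g m * \sum_(x in F) \sum_(y in F) c x y.
  rewrite (big_mkcond (fun x => x \in F)) mulr_sumr -sumrB; apply: eq_bigr => x _ /=.
  have -> : (if x \in F then \sum_(y in F) c x y else 0) =
    \sum_y (if (x \in F) && (y \in F) then c x y else 0).
    by case: (x \in F) => /=; rewrite ?[LHS]big_mkcond // big1.
  rewrite mulr_sumr -sumrB; apply: eq_bigr => y _.
  rewrite /g'; case: (boolP (x \in F)) => xF; case: (boolP (y \in F)) => yF /=.
  - by rewrite !mulr1 -addr_minl; lra.
  - rewrite mulr1 (gF y yF) !mulr0 !subr0.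
    by rewrite !min_r // ?subr_ge0 ?mmin // ?g0.
  - rewrite mulr1 (gF x xF) !mulr0 !subr0.
    by rewrite !min_l // ?subr_ge0 ?mmin // ?g0.
  - by rewrite !mulr0 !subr0.
have := expansion F.
have : 0 <= g m by exact: g0.
move=> gm0 hF h.
have := ler_wpM2l gm0 hF.
move: h; rewrite mulrBr mulrCA; lra.
Qed.

Hypothesis Phi_ge0 : 0 <= Phi.
Hypothesis Phi_lt1 : Phi < 1.

(* With [s^2 + Phi^2 = 1], the weights [1 + s] and [Phi] in the pointwise AM-GM
   bound of [|f(x)^2 - f(y)^2| = |f(x) - f(y)| |f(x) + f(y)|] are the ones that
   saturate Cauchy-Schwarz. *)
Lemma cheeger (f : T -> R) :
  `|\sum_x \sum_y c x y * (f x * f y)| <=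
    Num.sqrt (1 - Phi ^+ 2) * \sum_x pi x * f x ^+ 2.
Proof.
(* Passing to absolute values can only increase the left side and leaves the right side
   unchanged. *)
wlog f0 : f / forall x, 0 <= f x => [wl|].
  have := wl (fun x => `|f x|) (fun x => normr_ge0 _).
  under [X in _ <= _ * X]eq_bigr do rewrite real_normK ?num_real //.
  apply: le_trans; rewrite [leRHS]ger0_norm; last first.
    by apply: sumr_ge0 => x _; apply: sumr_ge0 => y _; rewrite !mulr_ge0.
  apply: (le_trans (ler_norm_sum _ _ _)); apply: ler_sum => x _.
  apply: (le_trans (ler_norm_sum _ _ _)); apply: ler_sum => y _.
  by rewrite !normrM (ger0_norm (c_ge0 x y)).
rewrite ger0_norm; last first.
  by apply: sumr_ge0 => x _; apply: sumr_ge0 => y _; rewrite !mulr_ge0.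
set s := Num.sqrt _.
have Phi2 : Phi ^+ 2 < 1 by rewrite expr_lt1 //.
have s2 : s ^+ 2 = 1 - Phi ^+ 2 by rewrite sqr_sqrtr // subr_ge0 ltW.
have s0 : 0 < s by rewrite sqrtr_gt0 subr_gt0.
have := @coarea (fun x => f x ^+ 2) (fun x => sqr_ge0 _).
set M := \sum_x _; set Q := \sum_x _; set S := \sum_x _ => hM.
pose a : R := 1 + s.
(* Apart from the killing term, this is the sum of [c x y / 2] times the square of
   [a |f x - f y| - Phi (f x + f y)], which is nonnegative. *)
have key : 2 * (a * Phi) * (S - M) <=
    a ^+ 2 * (S - Q) + Phi ^+ 2 * (S + Q).
  (* The killing at [x]: the part of [pi x] that no edge of the network carries. It is nonnegative
     by [c_pi]. *)
  pose k (x : T) : R := pi x - \sum_y c x y.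
  have SE : S = \sum_x k x * f x ^+ 2 + \sum_x \sum_y c x y * ((f x ^+ 2 + f y ^+ 2) / 2).
    have -> : \sum_x \sum_y c x y * ((f x ^+ 2 + f y ^+ 2) / 2) =
        \sum_x \sum_y c x y * f x ^+ 2.
      have -> : \sum_x \sum_y c x y * ((f x ^+ 2 + f y ^+ 2) / 2) =
        2^-1 * \sum_x \sum_y c x y * f x ^+ 2 + 2^-1 * \sum_x \sum_y c x y * f y ^+ 2.
        rewrite !mulr_sumr -big_split; apply: eq_bigr => x _ /=.
        by rewrite !mulr_sumr -big_split; apply: eq_bigr => y _ /=; lra.
      rewrite [X in _ + _ * X]exchange_big /=.
      under [X in _ + _ * X]eq_bigr do under eq_bigr do rewrite c_sym.
      by lra.
    rewrite -big_split; apply: eq_bigr => x _ /=.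
    rewrite -mulr_suml /k; lra.
  move: SE; set H := \sum_x _; set K := \sum_x _ => SE.
  have K0 : 0 <= (a - Phi) ^+ 2 * K.
    apply: mulr_ge0; first exact: sqr_ge0.
    by apply: sumr_ge0 => x _; rewrite mulr_ge0 ?sqr_ge0 // subr_ge0.
  have H0 : 0 <= (a - Phi) ^+ 2 * H + (Phi ^+ 2 - a ^+ 2) * Q + 2 * (a * Phi) * M.
    rewrite !mulr_sumr -!big_split; apply: sumr_ge0 => x _ /=.
    rewrite !mulr_sumr -!big_split; apply: sumr_ge0 => y _ /=.
    have [m|m] := leP (f x ^+ 2) (f y ^+ 2).
      have -> : (a - Phi) ^+ 2 * (c x y * ((f x ^+ 2 + f y ^+ 2) / 2)) +
        (Phi ^+ 2 - a ^+ 2) * (c x y * (f x * f y)) +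
        2 * (a * Phi) * (c x y * f x ^+ 2) =
        c x y * ((a * (f y - f x) - Phi * (f y + f x)) ^+ 2 / 2) by lra.
      by rewrite mulr_ge0 // divr_ge0 // sqr_ge0.
    have -> : (a - Phi) ^+ 2 * (c x y * ((f x ^+ 2 + f y ^+ 2) / 2)) +
      (Phi ^+ 2 - a ^+ 2) * (c x y * (f x * f y)) +
      2 * (a * Phi) * (c x y * f y ^+ 2) =
      c x y * ((a * (f x - f y) - Phi * (f x + f y)) ^+ 2 / 2) by lra.
    by rewrite mulr_ge0 // divr_ge0 // sqr_ge0.
  rewrite -subr_ge0 SE; apply: le_trans (addr_ge0 K0 H0) _.
  by rewrite le_eqVlt; apply/orP; left; apply/eqP; lra.
have hp : 2 * (a * Phi) * (Phi * S) <= 2 * (a * Phi) * (S - M).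
  by rewrite ler_wpM2l ?mulr_ge0 //; [rewrite addr_ge0 // ltW | lra].
(* From [a = 1 + s] and [Phi^2 = 1 - s^2] one gets [a^2 + Phi^2 = 2 a] and [a^2 - Phi^2 = 2 a s]. *)
have h : 2 * (a * s) * Q <= 2 * (a * s) * (s * S).
  have e1 : Phi ^+ 2 = 1 - s ^+ 2 by rewrite s2; lra.
  have := le_trans hp key.
  have -> : 2 * (a * Phi) * (Phi * S) = 2 * a * Phi ^+ 2 * S by lra.
  rewrite e1 /a => h; rewrite -subr_ge0; rewrite -subr_ge0 in h.
  by apply: le_trans h _; rewrite le_eqVlt; apply/orP; left; apply/eqP; lra.
by rewrite ler_pM2l // in h; rewrite !mulr_gt0 // addr_gt0.
Qed.
End Cheeger.

(** * The relative weight function *)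

Section Orbits.
Variable V : choiceType.
Implicit Types (H : set (V -> V)) (x y z : V).

Definition is_group H : Prop :=
  [/\ H id, forall g h, H g -> H h -> H (g \o h) &
      forall g, H g -> exists2 h, H h & cancel g h /\ cancel h g].

Definition orb H y : set V := [set g y | g in H].

Definition osize H y : nat := #|` fset_set (orb H y)|.

Lemma is_group_stabilizer H x : is_group H -> is_group (stabilizer H x).
Proof.
move=> [H1 HM HV]; split.
- by split.
- move=> g h [Hg gx] [Hh hx]; split; first exact: HM.
  by rewrite /= hx gx.
- move=> g [Hg gx]; have [h Hh [gh hg]] := HV g Hg.
  by exists h => //; split => //; rewrite -{1}gx gh.
Qed.

Lemma stabilizerC H x y :
  stabilizer (stabilizer H x) y = stabilizer (stabilizer H y) x.
Proof. by apply/seteqP; split => g [[? ?] ?]; split => //; split. Qed.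

Lemma card_fset_set_image (T U : choiceType) (f : T -> U) (A : set T) :
  finite_set A -> (forall u v, A u -> A v -> f u = f v -> u = v) ->
  #|` fset_set (f @` A)| = #|` fset_set A|.
Proof.
move=> fA finj; rewrite fset_set_image // card_in_imfset //= => u v.
by rewrite !in_fset_set // !inE => Au Av; exact: finj.
Qed.

Lemma osize_gt0 H y : is_group H -> finite_set (orb H y) -> (0 < osize H y)%N.
Proof.
move=> [H1 _ _] fH; rewrite cardfs_gt0; apply/fset0Pn; exists y.
by rewrite in_fset_set // inE; exists id.
Qed.

Lemma cardfs_prod (T U : choiceType) (A : {fset T}) (B : {fset U}) :
  #|` (A `*` B)%fset| = (#|` A| * #|` B|)%N.
Proof.
rewrite -(size_allpairs pair); apply: perm_size; apply: uniq_perm.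
- exact: fset_uniq.
- by apply: allpairs_uniq; rewrite ?fset_uniq // => -[? ?] [? ?].
- move=> [a b]; rewrite in_fsetM /=; apply/andP/allpairsP => [[aA bB]|].
    by exists (a, b).
  by move=> [[? ?] [? ? [-> ->]]].
Qed.

(** Orbit-stabilizer for pairs: the orbit of [(y, z)] fibres over the orbit of [y], and a
    transversal [t] identifies each fibre with the orbit of [z] under the stabilizer of [y]. *)
Lemma card_pair_orbit H y z : is_group H ->
  finite_set (orb H y) -> finite_set (orb (stabilizer H y) z) ->
  #|` fset_set [set (g y, g z) | g in H]| =
  (osize H y * osize (stabilizer H y) z)%N.
Proof.
move=> [H1 HM HV] fy fz.
have [t tP] : exists t : V -> V -> V,
    forall y', orb H y y' -> H (t y') /\ t y' y = y'.
  have /choice : forall y', exists g, orb H y y' -> H g /\ g y = y'.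
    move=> y'; have [[g Hg gy]|n] := pselect (orb H y y').
      by exists g.
    by exists id => h; case: n.
  by move=> [t tP]; exists t.
have -> : [set (g y, g z) | g in H] =
    (fun p => (p.1, t p.1 p.2)) @` (orb H y `*` orb (stabilizer H y) z).
  apply/seteqP; split => [_ [g Hg <-]|_ [[y' w] [/= hy' [g [Hg gy] <-]] <-]] /=.
    have [Ht ty] : H (t (g y)) /\ t (g y) y = g y by apply: tP; exists g.
    have [h Hh [th ht]] := HV _ Ht.
    exists (g y, h (g z)) => /=; last by rewrite ht.
    split; first by exists g.
    exists (h \o g) => //; split; first exact: HM.
    by rewrite /= -{1}ty th.
  have [Ht ty] := tP _ hy'.
  by exists (t y' \o g); [exact: HM | rewrite /= gy ty].
rewrite card_fset_set_image.
- by rewrite fset_setX // cardfs_prod.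
- exact: finite_setX.
- move=> [a b] [a' b'] [/= ha _] [/= ha' _] [<- e]; congr pair.
  have [Ht _] := tP _ ha; have [h _ [th _]] := HV _ Ht.
  by rewrite -(th b) e th.
Qed.

(** Both sides count the orbit of the pair [(y, z)], up to exchanging the coordinates. *)
Lemma orbit_index_swap H y z : is_group H ->
  (forall x, finite_set (orb H x)) ->
  (osize H y * osize (stabilizer H y) z = osize H z * osize (stabilizer H z) y)%N.
Proof.
move=> Hgp fH.
have fS a b : finite_set (orb (stabilizer H a) b).
  by apply: sub_finite_set (fH b) => _ [g [Hg _] <-]; exists g.
rewrite -!card_pair_orbit //.
have -> : [set (g z, g y) | g in H] =
    (fun p => (p.2, p.1)) @` [set (g y, g z) | g in H].
  by rewrite image_comp.
rewrite (card_fset_set_image (f := fun p : V * V => (p.2, p.1))) //; last first.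
  by move=> [? ?] [? ?] _ _ [-> ->].
apply: sub_finite_set (finite_setX (fH y) (fH z)).
by move=> _ [g Hg <-]; split; exists g.
Qed.

End Orbits.

Section RelativeWeight.
Variables (R : realType) (V : choiceType) (adj : rel V) (Gamma : set (V -> V)).
Hypothesis Gconn : connected_graph adj.
Hypothesis Glf : locally_finite_graph adj.
Hypothesis Ggrp : aut_subgroup adj Gamma.

Lemma is_group_aut : is_group Gamma.
Proof.
case: Ggrp => Gaut G1 GM GV; split => // g Gg.
have [[h gh hg] _] := Gaut g Gg.
by exists h; [exact: GV Gg _ _|].
Qed.

Lemma aut_adj g : Gamma g -> forall x y, adj (g x) (g y) = adj x y.
Proof. by case: Ggrp => Gaut _ _ _ /Gaut[]. Qed.

(** Induction along a path from [x]: the orbit of a neighbour of [w] lies among the neighbours of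
    the orbit of [w]. *)
Lemma finite_stab_orbit x y : finite_set (stab_orbit Gamma x y).
Proof.
have [s ps <-] := Gconn x y.
elim/last_ind: s ps => [|s z IH].
  move=> _; apply: (sub_finite_set _ (finite_set1 x)).
  by move=> _ [g [_ gx] <-].
rewrite rcons_path last_rcons => /andP[/IH fin_s sz].
apply: (@sub_finite_set _ _
  (\bigcup_(w in stab_orbit Gamma x (last x s)) [set y | adj w y])).
  move=> _ [g [Gg gx] <-]; exists (g (last x s)); first by exists g.
  by rewrite /= aut_adj.
by apply: bigcup_finite => // w _; exact: Glf.
Qed.

Lemma osize_stab_gt0 x y : (0 < osize (stabilizer Gamma x) y)%N.
Proof.
apply: osize_gt0; last exact: finite_stab_orbit.
by apply: is_group_stabilizer; exact: is_group_aut.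
Qed.

Lemma relwE y x :
  relw R Gamma y x =
  (osize (stabilizer Gamma x) y)%:R / (osize (stabilizer Gamma y) x)%:R.
Proof. by []. Qed.

Lemma relw_gt0 y x : 0 < relw R Gamma y x.
Proof. by rewrite relwE divr_gt0 // ltr0n osize_stab_gt0. Qed.

(** Apply [orbit_index_swap] inside the stabilizers of [x], [y] and [z]. Each of the three orbit
    sizes under a two-point stabilizer occurs in two of these identities, so they cancel and leave
    the cross-multiplied claim. *)
Lemma relw_cocycle x y z : relw R Gamma x y * relw R Gamma y z = relw R Gamma x z.
Proof.
have swap a b c :
    (osize (stabilizer Gamma a) b * osize (stabilizer (stabilizer Gamma a) b) c =
     osize (stabilizer Gamma a) c * osize (stabilizer (stabilizer Gamma a) c) b)%N.
  apply: orbit_index_swap; last by move=> w; exact: finite_stab_orbit.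
  by apply: is_group_stabilizer; exact: is_group_aut.
have t_gt0 a b c : (0 < osize (stabilizer (stabilizer Gamma a) b) c)%N.
  apply: osize_gt0; first by do 2!apply: is_group_stabilizer; exact: is_group_aut.
  apply: sub_finite_set (finite_stab_orbit a c).
  by move=> _ [g [Hg _] <-]; exists g.
rewrite !relwE.
have := swap z x y; have := swap y x z; have := swap x y z.
rewrite (stabilizerC _ z x) (stabilizerC _ z y) (stabilizerC _ y x).
have := t_gt0 x y z; have := t_gt0 x z y.
have := osize_stab_gt0 x y; have := osize_stab_gt0 y z; have := osize_stab_gt0 x z.
move: (osize (stabilizer Gamma x) y) (osize (stabilizer Gamma y) x) => b a.
move: (osize (stabilizer Gamma z) y) (osize (stabilizer Gamma y) z) => c d.
move: (osize (stabilizer Gamma z) x) (osize (stabilizer Gamma x) z) => e f.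
move: (osize _ z) (osize _ y) (osize _ x) => t1 t2 t3 f0 d0 b0 t2_gt0 t1_gt0 h1 h2 h3.
rewrite mulf_div; apply/eqP; rewrite eqr_div ?mulf_neq0 ?pnatr_eq0 -?lt0n //.
rewrite -!natrM eqr_nat -(@eqn_pmul2r (t1 * t2)) ?muln_gt0 ?t1_gt0 //; apply/eqP.
transitivity ((a * t1) * (f * t2) * c)%N; first by lia.
by rewrite h2 -h1; transitivity ((e * t2) * (d * (b * t1)))%N; [rewrite h3|]; lia.
Qed.

(** Conjugation by [g] carries the stabilizer of [a] to that of [g a], and [g] carries the orbits
    along. *)
Lemma relw_aut g x y : Gamma g -> relw R Gamma (g x) (g y) = relw R Gamma x y.
Proof.
move=> Gg.
suff h a b : osize (stabilizer Gamma (g a)) (g b) = osize (stabilizer Gamma a) b.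
  by rewrite !relwE !h.
have [_ GM GV] := is_group_aut.
have [k Gk [gk kg]] := GV g Gg.
rewrite /osize (_ : orb _ (g b) = g @` orb (stabilizer Gamma a) b).
  rewrite card_fset_set_image //; first exact: finite_stab_orbit.
  by move=> u v _ _; exact: (can_inj gk).
apply/seteqP; split => [_ [h [Gh hg] <-]|_ [_ [h [Gh hg] <-] <-]].
  exists (k (h (g b))); last by rewrite kg.
  exists (k \o (h \o g)) => //; split; first exact: GM Gk (GM _ _ Gh Gg).
  by rewrite /= hg gk.
exists (g \o (h \o k)); last by rewrite /= gk.
split; first exact: GM Gg (GM _ _ Gh Gk).
by rewrite /= gk hg.
Qed.

End RelativeWeight.

(** * Upper limits of sequences in the unit interval *)

Section LimnSup.
Variables (R : realType) (u : R^nat).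
Hypothesis u01 : forall n, 0 <= u n <= 1.

Let sdrop_ubound n : has_ubound (sdrop u n).
Proof. by exists 1 => _ [m _ <-]; case/andP: (u01 m). Qed.

Let sups_ge n m : (n <= m)%N -> u m <= sups u n.
Proof. by move=> nm; apply: ub_le_sup => //; exists m. Qed.

Let limn_sup_inf : limn_sup u = inf (range (sups u)).
Proof.
apply: limn_supE; exists 1; split => // M M1 n _ /=.
have /andP[un0 un1] := u01 n.
by rewrite ger0_norm // (le_trans un1) // ltW.
Qed.

Lemma limn_sup_le s N : (forall n, (N <= n)%N -> u n <= s) -> limn_sup u <= s.
Proof.
move=> us; rewrite limn_sup_inf; apply: (@le_trans _ _ (sups u N)).
  apply: ge_inf; last by exists N.
  exists 0 => _ [n _ <-]; apply: le_trans (sups_ge (leqnn n)).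
  by case/andP: (u01 n).
apply: ge_sup; first by exists (u N), N => /=.
by move=> _ [n /= Nn <-]; exact: us.
Qed.

Lemma limn_sup_ge l : (forall N, exists2 n, (N <= n)%N & l <= u n) -> l <= limn_sup u.
Proof.
move=> lu; rewrite limn_sup_inf; apply: lb_le_inf; first by exists (sups u 0), 0%N.
move=> _ [N _ <-]; have [n Nn ln] := lu N.
exact: le_trans ln (sups_ge Nn).
Qed.

End LimnSup.

Lemma root_expn (R : realType) (a : R) n : 0 <= a -> (0 < n)%N ->
  (a ^+ n) `^ n%:R^-1 = a.
Proof.
move=> a0 n0; rewrite -powR_mulrn // -powRrM divff ?powRr1 //.
by rewrite pnatr_eq0 -lt0n.
Qed.

(** * Sums over finite sets and their suprema *)

Lemma sum_fset_le (R : numDomainType) (V : choiceType) (A B : {fset V}) (F : V -> R) :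
  (A `<=` B)%fset -> (forall x, x \in B -> 0 <= F x) ->
  \sum_(x <- A) F x <= \sum_(x <- B) F x.
Proof.
move=> AB F0; rewrite [leRHS](big_fsetID _ (mem A)) /=.
rewrite [X in _ <= X + _](_ : _ = \sum_(x <- A) F x); last first.
  apply: eq_fbigl => x; rewrite !inE /=.
  by apply/andP/idP => [[]//|xA]; split=> //; exact: (fsubsetP AB).
rewrite lerDl big_seq; apply: sumr_ge0 => x; rewrite !inE /= => /andP[xB _].
exact: F0.
Qed.

Lemma sum_fset_subset (R : nmodType) (V : choiceType) (B : {fset V})
    (F : {set B}) (f : V -> R) :
  \sum_(x in F) f (val x) = \sum_(x <- [fset val x | x in F]%fset) f x.
Proof.
rewrite big_imfset /=; last by move=> x y _ _ /val_inj.
by rewrite [RHS]big_enum_cond; apply: eq_bigl => x; rewrite andbT.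
Qed.

Section RealEsum.
Variables (R : realType) (T : choiceType) (f : T -> R).
Hypothesis f_ge0 : forall x, 0 <= f x.

Lemma esum_fsetE (X : {fset T}) :
  (\esum_(x in [set` X]) (f x)%:E)%E = (\sum_(x <- X) f x)%:E.
Proof.
rewrite esum_fset //; last by move=> x _; rewrite lee_fin.
by rewrite fsbig_finite // set_fsetK sumEFin.
Qed.

Lemma sum_fset_le_esum (X : {fset T}) (A : set T) : [set` X] `<=` A ->
  ((\sum_(x <- X) f x)%:E <= \esum_(x in A) (f x)%:E)%E.
Proof.
move=> XA; apply: esum_ge; exists [set` X]; first by split.
by rewrite fsbig_finite // set_fsetK sumEFin.
Qed.

Lemma esum_le_fset (A : set T) (c : \bar R) :
  (forall X : {fset T}, [set` X] `<=` A -> ((\sum_(x <- X) f x)%:E <= c)%E) ->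
  (\esum_(x in A) (f x)%:E <= c)%E.
Proof.
move=> h; apply: ge_ereal_sup => _ [X [fX XA] <-].
by rewrite fsbig_finite // sumEFin; apply: h; rewrite fset_setK.
Qed.

End RealEsum.

Lemma divEFin (R : realType) (a b : R) : b != 0 -> (a%:E / b%:E)%E = (a / b)%:E.
Proof. by move=> b0; rewrite inver (negPf b0). Qed.

Lemma fset1_neq0 (T : choiceType) (x : T) : [fset x]%fset != fset0.
Proof. by apply/fset0Pn; exists x; rewrite inE. Qed.

Lemma set_fset_neq0 (T : choiceType) (X : {fset T}) : X != fset0 -> [set` X] !=set0.
Proof. by move=> /fset0Pn[x xX]; exists x. Qed.

(** * The biased random walk and its expansion *)

Section Walk.
Variables (R : realType) (V : choiceType) (adj : rel V) (Gamma : set (V -> V)).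
Variable o : V.
Hypothesis adj_sym : symmetric adj.
Hypothesis Gconn : connected_graph adj.
Hypothesis Glf : locally_finite_graph adj.
Hypothesis Gedge : exists y z : V, adj y z.
Hypothesis Ggrp : aut_subgroup adj Gamma.
Hypothesis Gtr : acts_transitively Gamma.

Let relw := relw R Gamma.
Let step := walk_step R adj Gamma o.
Let nstep := walk_nstep R adj Gamma o.
Let D : R := walk_norm R adj Gamma o.

Definition nb x : {fset V} := fset_set [set y | adj x y].

(* [hw], [aker] and [cnd] are the h, a and c of the header. *)
Definition hw x : R := Num.sqrt (relw o x).

Definition aker x y : R := (adj x y)%:R / D.

Definition cnd x y : R := aker x y * (hw x * hw y).

Lemma mem_nb x y : (y \in nb x) = adj x y.
Proof. by rewrite in_fset_set ?inE //; apply/idP/idP; rewrite inE. Qed.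

Lemma nb_sum (x : V) (F : V -> R) : (forall z, ~~ adj x z -> F z = 0) ->
  \sum_(z \in [set: V]) F z = \sum_(z <- nb x) F z.
Proof.
move=> F0; rewrite -fsbig_finite //; apply/esym/fsbig_widen => // z [_ /= nz].
by apply: F0; apply/negP.
Qed.

Lemma walk_normE x : D = \sum_(z <- nb x) Num.sqrt (relw x z).
Proof.
(* Extending the sum by zero to all of [V] allows reindexing by an automorphism taking [o] to
   [x]. *)
have DE y : \sum_(z <- nb y) Num.sqrt (relw y z) =
    \sum_(z \in [set: V]) (if adj y z then Num.sqrt (relw y z) else 0).
  rewrite (nb_sum (x := y)) => [|z /negPf -> //].
  by rewrite big_seq [RHS]big_seq; apply: eq_bigr => z; rewrite mem_nb => ->.
have [g Gg <-] := Gtr o x.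
have [k _ [gk kg]] : exists2 k, Gamma k & cancel g k /\ cancel k g.
  by have [_ _] := is_group_aut Ggrp; apply.
rewrite /D /walk_norm fsbig_finite // -/(nb o) DE.
rewrite DE [RHS](reindex_fsbigT g); last by exists k.
apply: eq_fsbigr => z _.
by rewrite (aut_adj Ggrp Gg) /relw (relw_aut _ Gconn Glf Ggrp).
Qed.

Lemma hw_gt0 x : 0 < hw x.
Proof. by rewrite sqrtr_gt0; exact: relw_gt0 Gconn Glf Ggrp _ _. Qed.

Lemma hw_ge0 x : 0 <= hw x.
Proof. exact: sqrtr_ge0. Qed.

Lemma hw_neq0 x : hw x != 0. Proof. by rewrite gt_eqF // hw_gt0. Qed.

Lemma hw_sq x : hw x ^+ 2 = relw o x.
Proof. by rewrite sqr_sqrtr // ltW //; exact: relw_gt0 Gconn Glf Ggrp _ _. Qed.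

Lemma hw_step x y : Num.sqrt (relw x y) = hw y / hw x.
Proof.
apply: (mulfI (hw_neq0 x)); rewrite mulrCA divff ?hw_neq0 // mulr1.
rewrite -sqrtrM; last by apply: ltW; exact: relw_gt0 Gconn Glf Ggrp _ _.
by rewrite /hw /relw (relw_cocycle _ Gconn Glf Ggrp).
Qed.

(** Transitivity carries the given edge to every vertex; this is what makes [D] positive. *)
Lemma exists_nb x : exists y, adj x y.
Proof.
have [y [z yz]] := Gedge; have [g Gg <-] := Gtr y x.
by exists (g z); rewrite (aut_adj Ggrp Gg).
Qed.

Lemma walk_norm_gt0 : 0 < D.
Proof.
have [y oy] := exists_nb o.
rewrite (walk_normE o) (big_fsetD1 y) ?mem_nb //=.
apply: ltr_wpDr; first by apply: sumr_ge0 => z _; exact: sqrtr_ge0.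
by rewrite sqrtr_gt0; exact: relw_gt0 Gconn Glf Ggrp _ _.
Qed.

Lemma hw_harmonic x : \sum_(z <- nb x) hw z = D * hw x.
Proof.
rewrite (walk_normE x) mulr_suml; apply: eq_bigr => z _.
by rewrite hw_step mulfVK // hw_neq0.
Qed.

Lemma aker_sym x y : aker x y = aker y x.
Proof. by rewrite /aker adj_sym. Qed.

Lemma aker_ge0 x y : 0 <= aker x y.
Proof. by rewrite divr_ge0 // ltW // walk_norm_gt0. Qed.

Lemma aker_notadj x y : ~~ adj x y -> aker x y = 0.
Proof. by rewrite /aker => /negPf ->; rewrite mul0r. Qed.

Lemma cnd_sym x y : cnd x y = cnd y x.
Proof. by rewrite /cnd aker_sym (mulrC (hw x)). Qed.

Lemma cnd_ge0 x y : 0 <= cnd x y.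
Proof. exact: mulr_ge0 (aker_ge0 _ _) (mulr_ge0 (hw_ge0 _) (hw_ge0 _)). Qed.

(** The conjugation of the walk into [aker], written without division. *)
Lemma step_aker x y : hw x * step x y = aker x y * hw y.
Proof.
rewrite /step /walk_step /aker; case: ifP => _; last by rewrite mulr0 !mul0r.
by rewrite -/(relw x y) hw_step mulrA mulrCA divff ?hw_neq0 // mulr1 mul1r mulrC.
Qed.

Lemma conductanceE x y : conductance R adj Gamma o x y = cnd x y.
Proof.
by rewrite /conductance -/(relw o x) -/(step x y) -hw_sq expr2 -mulrA step_aker
  /cnd mulrCA.
Qed.

Lemma step_ge0 x y : 0 <= step x y.
Proof.
rewrite /step /walk_step; case: ifP => // _.
by rewrite divr_ge0 ?sqrtr_ge0 // ltW // walk_norm_gt0.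
Qed.

Lemma cnd_sum_nb x : \sum_(y <- nb x) cnd x y = relw o x.
Proof.
have -> : \sum_(y <- nb x) cnd x y = \sum_(y <- nb x) (hw x / D) * hw y.
  rewrite big_seq [RHS]big_seq; apply: eq_bigr => y; rewrite mem_nb => xy.
  by rewrite /cnd /aker xy mul1r mulrA (mulrC D^-1).
rewrite -mulr_sumr hw_harmonic mulrA mulfVK -?expr2 ?hw_sq //.
by rewrite gt_eqF // walk_norm_gt0.
Qed.

Lemma nb_sum_fset (B : {fset V}) x (F : V -> R) :
  (forall z, 0 <= F z) -> (forall z, ~~ adj x z -> F z = 0) ->
  \sum_(z <- B) F z <= \sum_(z <- nb x) F z.
Proof.
move=> F0 Fz; rewrite [leRHS](big_fset_incl _ (fsubsetUl _ B)).
  by apply: sum_fset_le => //; exact: fsubsetUr.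
by move=> z _; rewrite mem_nb; exact: Fz.
Qed.

Lemma cnd_sum_le (B : {fset V}) x : \sum_(y <- B) cnd x y <= relw o x.
Proof.
rewrite -cnd_sum_nb; apply: nb_sum_fset => [z|z xz]; first exact: cnd_ge0.
by rewrite /cnd aker_notadj // mul0r.
Qed.

(** * Return probabilities and their truncation to finite vertex sets *)

Lemma nstepS n x y : nstep n.+1 x y = \sum_(z <- nb x) step x z * nstep n z y.
Proof.
rewrite /nstep /= (nb_sum (x := x)) // => z /negPf xz.
by rewrite /walk_step xz mul0r.
Qed.

Lemma nstep_ge0 n x y : 0 <= nstep n x y.
Proof.
elim: n x => [|n IH] x; first by rewrite /nstep /=.
by rewrite nstepS; apply: sumr_ge0 => z _; rewrite mulr_ge0 // step_ge0.
Qed.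

Lemma nstep_aut g n x y : Gamma g -> nstep n (g x) (g y) = nstep n x y.
Proof.
move=> Gg.
have [k _ [gk kg]] : exists2 k, Gamma k & cancel g k /\ cancel k g.
  by have [_ _] := is_group_aut Ggrp; apply.
elim: n x => [|n IH] x; first by rewrite /nstep /= (can_eq gk).
rewrite /nstep /= (reindex_fsbigT g); last by exists k.
apply: eq_fsbigr => z _; rewrite -/nstep IH /walk_step.
by rewrite (aut_adj Ggrp Gg) (relw_aut _ Gconn Glf Ggrp).
Qed.

Lemma nstep_diag n x y : nstep n x x = nstep n y y.
Proof. by have [g Gg <-] := Gtr x y; rewrite nstep_aut. Qed.

(** Powers of [aker] along paths whose vertices after the first lie in [B]. The arguments range over
    [V], not [B], so that induction can compare them with [nstep]. *)
Fixpoint trunc (B : {fset V}) n x y : R :=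
  if n is n'.+1 then \sum_(z <- B) aker x z * trunc B n' z y else (x == y)%:R.

Lemma trunc_kpow (B : {fset V}) n (x y : B) :
  kpow (fun a b : B => aker (val a) (val b)) n x y = trunc B n (val x) (val y).
Proof.
elim: n x => [|n IH] x /=; first by rewrite /kpow /= val_eqE.
rewrite big_seq_fsetE /=; apply: eq_bigr => z _.
by rewrite -IH.
Qed.

(** Confinement to [B] only discards nonnegative terms. *)
Lemma trunc_le B n x y : trunc B n x y * hw y <= hw x * nstep n x y.
Proof.
elim: n x => [|n IH] x.
  by rewrite /nstep /=; case: eqP => [->|_]; rewrite ?mul0r ?mulr0 // mulrC.
rewrite nstepS /= mulr_suml mulr_sumr.
under [leRHS]eq_bigr do rewrite mulrA step_aker -mulrA.
apply: (@le_trans _ _ (\sum_(z <- B) aker x z * (hw z * nstep n z y))).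
  by apply: ler_sum => z _; rewrite -mulrA ler_wpM2l // aker_ge0.
apply: nb_sum_fset => [z|z /aker_notadj ->]; last by rewrite mul0r.
exact: mulr_ge0 (aker_ge0 _ _) (mulr_ge0 (hw_ge0 _) (nstep_ge0 _ _ _)).
Qed.

Lemma trunc_eq n x y : exists B0 : {fset V}, forall B : {fset V},
  (B0 `<=` B)%fset -> trunc B n x y * hw y = hw x * nstep n x y.
Proof.
elim: n x => [|n IH] x.
  exists fset0 => B _.
  by rewrite /nstep /=; case: eqP => [->|_]; rewrite ?mul0r ?mulr0 // mulrC.
have [f fP] := choice IH.
(* The first step lands in [nb x], and [f z] serves the [n] steps that remain from [z]. *)
exists (nb x `|` \bigcup_(z <- nb x) f z)%fset => B; rewrite fsubUset => /andP[nB fB].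
rewrite nstepS /= mulr_suml mulr_sumr.
rewrite -(big_fset_incl _ nB); last first.
  by move=> z _; rewrite mem_nb => /aker_notadj ->; rewrite !mul0r.
rewrite big_seq [RHS]big_seq; apply: eq_bigr => z xz.
rewrite mulrA step_aker -!mulrA fP //.
by apply: fsubset_trans fB; exact: bigfcup_sup.
Qed.

Lemma nstep_double_le (Phi : R) n x : 0 <= Phi -> Phi < 1 ->
  (forall F : {fset V}, \sum_(x <- F) \sum_(y <- F) cnd x y <=
     (1 - Phi) * \sum_(x <- F) relw o x) ->
  nstep (2 * n) x x <= Num.sqrt (1 - Phi ^+ 2) ^+ (2 * n).
Proof.
move=> Phi0 Phi1 hPhi.
have [B0 hB0] := trunc_eq (2 * n) x x.
pose B := (x |` B0)%fset.
have xB : x \in B by rewrite fset1U1.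
have := hB0 B (fsubsetUr _ _); rewrite mulrC => /(mulfI (hw_neq0 x)) <-.
have -> : trunc B (2 * n) x x =
    kpow (fun a b : B => aker (val a) (val b)) (2 * n) [` xB]%fset [` xB]%fset.
  by rewrite trunc_kpow.
apply: kpow_double_le => [a b||g]; first exact: aker_sym.
  by rewrite sqrtr_gt0 subr_gt0 expr_lt1.
(* Dividing [g] by [hw] turns the conductance form into that of [aker] and the weighted norm into
   the plain one. *)
have := @cheeger R B (fun a b => cnd (val a) (val b)) (fun a => relw o (val a)) Phi
  _ _ _ _ Phi0 Phi1 (fun a => g a / hw (val a)).
have -> : \sum_(a : B) \sum_(b : B) cnd (val a) (val b) *
    (g a / hw (val a) * (g b / hw (val b))) =
    dot g (kapp (fun a b : B => aker (val a) (val b)) g).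
  apply: eq_bigr => a _; rewrite mulr_sumr; apply: eq_bigr => b _.
  have hK c : hw (val c) * (g c / hw (val c)) = g c.
    by rewrite mulrC mulfVK ?hw_neq0.
  by rewrite /cnd -[LHS]mulrA [X in _ * X]mulrACA !hK mulrCA.
have -> : \sum_(a : B) relw o (val a) * (g a / hw (val a)) ^+ 2 = dot g g.
  apply: eq_bigr => a _.
  by rewrite -hw_sq -exprMn mulrC mulfVK ?hw_neq0 // expr2.
apply.
- by move=> a b; exact: cnd_sym.
- by move=> a b; exact: cnd_ge0.
- by move=> a; rewrite -(big_seq_fsetE _ _ xpredT (cnd (val a))) cnd_sum_le.
- move=> F; rewrite (sum_fset_subset F (relw o)).
  under eq_bigr do rewrite (sum_fset_subset F (cnd (val _))).
  by rewrite (sum_fset_subset F (fun a => \sum_(b <- _) cnd a b)).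
Qed.

(** The test vector is [hw] on [F], whose Rayleigh quotient is the base on the left. By transitivity
    one return probability bounds all the diagonal entries. *)
Lemma nstep_double_ge (F : {fset V}) n x : F != fset0 ->
  ((\sum_(x <- F) \sum_(y <- F) cnd x y) / \sum_(x <- F) relw o x) ^+ (2 * n) <=
  #|` F|%:R * nstep (2 * n) x x.
Proof.
move=> /fset0Pn[x0 x0F].
have w0 : 0 < \sum_(y <- F) relw o y.
  rewrite (big_fsetD1 x0) //= ltr_wpDr -?hw_sq ?exprn_gt0 ?hw_gt0 //.
  by apply: sumr_ge0 => y _; rewrite -hw_sq sqr_ge0.
pose u := fun a : F => hw (val a).
have uu : dot u u = \sum_(y <- F) relw o y.
  by rewrite big_seq_fsetE; apply: eq_bigr => a _; rewrite -hw_sq.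
rewrite cardfE; apply: (@kpow_double_ge _ _ (fun a b : F => aker (val a) (val b)) _ u).
- by move=> a b; exact: aker_sym.
- apply: divr_ge0; last exact: ltW.
  by apply: sumr_ge0 => a _; apply: sumr_ge0 => b _; exact: cnd_ge0.
- by rewrite uu.
- rewrite uu mulfVK ?gt_eqF // big_seq_fsetE; apply: eq_bigr => a _ /=.
  rewrite big_seq_fsetE mulr_sumr; apply: eq_bigr => b _ /=.
  by rewrite /cnd mulrCA.
- move=> a; rewrite trunc_kpow (nstep_diag _ x (val a)).
  by rewrite -(ler_pM2r (hw_gt0 (val a))) [leRHS]mulrC trunc_le.
Qed.

(** * Edge expansion *)

Definition wt (X : {fset V}) : R := \sum_(x <- X) relw o x.

(** The conductance leaving [A] through [x], a finite real sum even when [A] is infinite. *)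
Definition flow (A : set V) x : R := \sum_(y <- nb x | y \notin A) cnd x y.

Definition out (X : {fset V}) : R := \sum_(x <- X) flow [set` X] x.

Let w_gt0 x : 0 < relw o x. Proof. exact: relw_gt0 Gconn Glf Ggrp _ _. Qed.

Let w_ge0 x : 0 <= relw o x. Proof. exact: ltW. Qed.

Lemma cnd_notadj x y : ~~ adj x y -> cnd x y = 0.
Proof. by move=> xy; rewrite /cnd aker_notadj // mul0r. Qed.

#[local] Hint Resolve cnd_ge0 : core.

Lemma wt_gt0 X : X != fset0 -> 0 < wt X.
Proof.
move=> /fset0Pn[x xX]; rewrite /wt (big_fsetD1 x) //= ltr_wpDr //.
exact: sumr_ge0.
Qed.

Lemma flow_ge0 A x : 0 <= flow A x.
Proof. by apply: sumr_ge0 => y _. Qed.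

Lemma flow_le A x : flow A x <= relw o x.
Proof.
rewrite -cnd_sum_nb /flow [leLHS]big_mkcond.
by apply: ler_sum => y _; case: ifP => // _; exact: cnd_ge0.
Qed.

(** The total conductance at a vertex is its weight, so what leaves [X] is the weight of [X] minus
    what stays inside. *)
Lemma outE X : out X = wt X - \sum_(x <- X) \sum_(y <- X) cnd x y.
Proof.
rewrite /out /wt -sumrB; apply: eq_bigr => x _.
rewrite -cnd_sum_nb.
rewrite [in RHS](bigID (fun y => y \in [set` X])) /= -/(flow [set` X] x).
suff -> : \sum_(y <- nb x | y \in [set` X]) cnd x y = \sum_(y <- X) cnd x y.
  by rewrite addrAC subrr add0r.
rewrite big_fset_condE; apply: big_fset_incl.
  by apply/fsubsetP => y; rewrite !inE /= mem_setE => /andP[].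
move=> y yX; rewrite !inE /= mem_setE yX andbT mem_nb; exact: cnd_notadj.
Qed.

Lemma set_weight_fset X : set_weight R Gamma o [set` X] = (wt X)%:E.
Proof. by rewrite /set_weight esum_fsetE. Qed.

Lemma boundary_conductanceE A :
  boundary_conductance R adj Gamma o A = (\esum_(x in A) (flow A x)%:E)%E.
Proof.
rewrite /boundary_conductance.
transitivity (\esum_(x in A) \esum_(y in [set y | adj x y /\ ~ A y]) (cnd x y)%:E)%E.
  rewrite esum_esum; last by move=> x y _ _; rewrite lee_fin.
  rewrite (_ : edge_boundary adj A = A `*`` (fun x => [set y | adj x y /\ ~ A y])).
    apply: eq_esum => -[x y] _ /=.
    by rewrite conductanceE.
  by apply/seteqP; split => -[x y] /= [] => [? ? ?|? [? ?]]; do ?split.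
apply: eq_esum => x _.
rewrite (_ : [set y | adj x y /\ ~ A y] = [set` [fset y in nb x | y \notin A]%fset]).
  rewrite esum_fsetE // /flow; congr (_%:E); rewrite [RHS]big_fset_condE.
  by apply: eq_fbigl => y; rewrite !inE.
apply/seteqP; split => y /=; rewrite !inE /= mem_nb.
  by move=> [-> nA]; apply/negP; rewrite inE.
by move=> /andP[-> /negP nA]; split => // Ay; apply: nA; rewrite inE.
Qed.

Lemma boundary_conductance_fset X :
  boundary_conductance R adj Gamma o [set` X] = (out X)%:E.
Proof. by rewrite boundary_conductanceE esum_fsetE //; exact: flow_ge0. Qed.

Lemma ratio_ge0 A :
  (0 <= boundary_conductance R adj Gamma o A / set_weight R Gamma o A)%E.
Proof.
rewrite boundary_conductanceE; apply: mule_ge0.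
  by apply: esum_ge0 => x _; rewrite lee_fin flow_ge0.
by rewrite inve_ge0; apply: esum_ge0 => x _; rewrite lee_fin.
Qed.

Let Phi : R := edge_expansion R adj Gamma o.

(** The infimum is finite, being nonnegative and at most the ratio of the singleton of [o]; so
    [fine] can be undone. *)
Lemma edge_expansion_ereal : Phi%:E = ereal_inf
  [set (boundary_conductance R adj Gamma o F / set_weight R Gamma o F)%E
  | F in [set F | F !=set0 /\ (set_weight R Gamma o F < +oo)%E]].
Proof.
rewrite /Phi /edge_expansion fineK // ge0_fin_numE; last first.
  by apply: le_ereal_inf_tmp => _ [F _ <-]; exact: ratio_ge0.
apply: (@le_lt_trans _ _ (out [fset o]%fset / wt [fset o]%fset)%:E); last exact: ltry.
apply: ereal_inf_lbound; exists [set` [fset o]%fset].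
  by split; [exact/set_fset_neq0/fset1_neq0 | rewrite set_weight_fset ltry].
rewrite boundary_conductance_fset set_weight_fset divEFin // gt_eqF //.
by rewrite wt_gt0 // fset1_neq0.
Qed.

Lemma edge_expansion_ge0 : 0 <= Phi.
Proof.
rewrite -lee_fin edge_expansion_ereal.
by apply: le_ereal_inf_tmp => _ [F _ <-]; exact: ratio_ge0.
Qed.

Lemma edge_expansion_le X : Phi * wt X <= out X.
Proof.
have [->|X0] := eqVneq X fset0; first by rewrite /wt /out !big_seq_fset0 mulr0.
rewrite -ler_pdivlMr ?wt_gt0 // -lee_fin edge_expansion_ereal.
apply: ereal_inf_lbound; exists [set` X].
  by split; [exact/set_fset_neq0 | rewrite set_weight_fset ltry].
by rewrite boundary_conductance_fset set_weight_fset divEFin // gt_eqF // wt_gt0.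
Qed.

(** For two adjacent vertices, the edge between them carries positive conductance that does not
    leave the pair. *)
Lemma edge_expansion_lt1 : Phi < 1.
Proof.
have [y oy] := exists_nb o.
have := edge_expansion_le [fset o; y]%fset.
rewrite outE => h.
have w0 : 0 < wt [fset o; y]%fset.
  by apply: wt_gt0; apply/fset0Pn; exists o; rewrite !inE eqxx.
suff c0 : 0 < \sum_(a <- [fset o; y]%fset) \sum_(b <- [fset o; y]%fset) cnd a b.
  by rewrite -(ltr_pM2r w0) mul1r; apply: le_lt_trans h _; rewrite ltrBlDr ltrDl.
have oX : o \in [fset o; y]%fset by rewrite !inE eqxx.
have yX : y \in [fset o; y]%fset by rewrite !inE eqxx orbT.
rewrite (big_fsetD1 o) //= ltr_wpDr //.
  by apply: sumr_ge0 => a _; exact: sumr_ge0.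
rewrite (big_fsetD1 y) //= ltr_wpDr //; first exact: sumr_ge0.
rewrite /cnd /aker oy mul1r !mulr_gt0 ?hw_gt0 //.
by rewrite invr_gt0; exact: walk_norm_gt0.
Qed.

(* For finite [X] inside [F], the edges leaving [X] either leave [F] or end in a
   finite [Y] inside [F] minus [X], and the latter carry at most the weight of [Y].
   Hence [phi w(X) <= c(dF) + w(F) - w(X)], and [X] exhausts [F]. *)
Lemma boundary_infinite_ge (phi : R) (F : set V) : 0 <= phi ->
  (forall X, phi * wt X <= out X) -> (set_weight R Gamma o F < +oo)%E ->
  (phi%:E * set_weight R Gamma o F <= boundary_conductance R adj Gamma o F)%E.
Proof.
move=> phi0 hphi wF.
have wFfin : set_weight R Gamma o F \is a fin_num.
  by rewrite ge0_fin_numE //; apply: esum_ge0 => x _; rewrite lee_fin.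
have bF : (boundary_conductance R adj Gamma o F \is a fin_num).
  rewrite ge0_fin_numE; last first.
    rewrite boundary_conductanceE; apply: esum_ge0 => x _.
    by rewrite lee_fin flow_ge0.
  apply: le_lt_trans wF; rewrite boundary_conductanceE; apply: le_esum => x _.
  by rewrite lee_fin flow_le.
have hW1 := @esum_le_fset _ _ (relw o) F; have hW2 := @sum_fset_le_esum _ _ (relw o).
have hB := @sum_fset_le_esum _ _ (flow F).
have {}hW2 X := hW2 X F; have {}hB X := hB X F.
rewrite -boundary_conductanceE in hB; rewrite -/(set_weight R Gamma o F) in hW1 hW2.
move: (set_weight R Gamma o F) (boundary_conductance R adj Gamma o F)
  wFfin bF hB hW1 hW2 {wF} => [W||] [B||] // _ _ hB hW1 hW2.
rewrite -EFinM lee_fin.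
(* The bound on [X] rearranges to [(phi + 1) w(X) <= B + W], whose right side is free of [X], so the
   supremum over [X] may be taken. *)
suff : W <= (B + W) / (phi + 1).
  by rewrite ler_pdivlMr ?ltr_wpDl //; lra.
rewrite -lee_fin; apply: hW1 => X XF; rewrite lee_fin ler_pdivlMr ?ltr_wpDl //.
pose Y := [fset y in (\bigcup_(x <- X) nb x)%fset | (y \notin X) && (y \in F)]%fset.
have hflow x : x \in X -> flow [set` X] x <= flow F x + \sum_(y <- Y) cnd x y.
  move=> xX; rewrite /flow (bigID (fun y => y \in F)) /= addrC lerD //.
    rewrite le_eqVlt; apply/orP; left; apply/eqP; apply: eq_bigl => y.
    rewrite mem_setE; apply: andb_idl => yF.
    by apply: contra yF => yX; rewrite inE; exact: XF.
  rewrite big_fset_condE; apply: sum_fset_le => //.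
  apply/fsubsetP => y; rewrite !inE /= mem_setE => /andP[yx ->]; rewrite andbT.
  by apply/bigfcupP; exists x => //; rewrite xX.
have hout : out X <= B + wt Y.
  apply: (@le_trans _ _ (\sum_(x <- X) (flow F x + \sum_(y <- Y) cnd x y))).
    by rewrite /out big_seq [leRHS]big_seq; apply: ler_sum => x; exact: hflow.
  rewrite big_split /= lerD //; first by rewrite -lee_fin hB.
  rewrite exchange_big /=; apply: ler_sum => y _.
  under eq_bigr do rewrite cnd_sym.
  exact: cnd_sum_le.
have hXY : wt X + wt Y <= W.
  rewrite -lee_fin; apply: le_trans (hW2 (X `|` Y)%fset _); last first.
    move=> y /=; rewrite !inE /= => /orP[/XF //|/andP[_ /andP[_]]].
    by rewrite inE.
  rewrite lee_fin [leRHS](big_fsetID _ (mem X)) /= lerD //.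
    apply: sum_fset_le => //.
    by apply/fsubsetP => y yX; rewrite !inE /= yX.
  apply: sum_fset_le => //.
  apply/fsubsetP => y; rewrite !inE /= => /andP[-> /andP[/negPf -> ->]].
  by [].
have := hphi X; rewrite -/(wt X); lra.
Qed.

(** Lower bounds on [Phi] need testing on finite sets only. *)
Lemma edge_expansion_ge (phi : R) : 0 <= phi ->
  (forall X, phi * wt X <= out X) -> phi <= Phi.
Proof.
move=> phi0 hphi; rewrite -lee_fin edge_expansion_ereal.
apply: le_ereal_inf_tmp => _ [F [[x Fx] wF] <-].
have := boundary_infinite_ge phi0 hphi wF.
have : (0 < set_weight R Gamma o F)%E.
  apply: (@lt_le_trans _ _ (relw o x)%:E); first by rewrite lte_fin.
  have := @sum_fset_le_esum _ _ (relw o) [fset x]%fset F.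
  rewrite big_seq_fset1; apply => y /=; rewrite inE => /eqP -> //.
case: (set_weight R Gamma o F) wF => // r _; rewrite lte_fin => r0.
by rewrite inver gt_eqF // lee_pdivlMr.
Qed.

(** * Vertex boundary and amenability *)

Definition bdry (X : {fset V}) : {fset V} :=
  [fset y in (\bigcup_(x <- X) nb x)%fset | y \notin X]%fset.

Lemma outer_boundary_fset X : outer_boundary adj [set` X] = [set` bdry X].
Proof.
apply/seteqP; split => y /=; rewrite !inE /=.
  move=> [/negP -> [x xX xy]]; rewrite andbT; apply/bigfcupP.
  by exists x; rewrite ?mem_nb // xX.
move=> /andP[/bigfcupP[x /andP[xX _]]]; rewrite mem_nb => xy /negP yX.
by split => //; exists x.
Qed.

(** The boundary edges are regrouped by their outer endpoint. *)
Lemma out_bdry X : out X = \sum_(y <- bdry X) \sum_(x <- X) cnd y x.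
Proof.
rewrite exchange_big /= /out big_seq [RHS]big_seq; apply: eq_bigr => x xX.
under [RHS]eq_bigr do rewrite cnd_sym.
rewrite /flow big_fset_condE; apply: big_fset_incl.
  apply/fsubsetP => y; rewrite !inE /= mem_setE => /andP[xy ->]; rewrite andbT.
  by apply/bigfcupP; exists x => //; rewrite xX.
move=> y; rewrite !inE /= mem_setE => /andP[_ ->]; rewrite andbT mem_nb.
exact: cnd_notadj.
Qed.

Lemma out_le_bdry X : out X <= wt (bdry X).
Proof.
rewrite out_bdry; apply: ler_sum => y _.
exact: cnd_sum_le.
Qed.

(** A boundary vertex [y] has a neighbour [x] in [X]. Harmonicity at [x] gives [h(y) <= D h(x)], so
    [w(y) <= D h(x) h(y) = D^2 c(y,x)]. *)
Lemma bdry_le_out X : wt (bdry X) <= D ^+ 2 * out X.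
Proof.
have D0 : 0 < D by exact: walk_norm_gt0.
rewrite out_bdry mulr_sumr /wt big_seq [leRHS]big_seq; apply: ler_sum => y.
rewrite !inE /= => /andP[/bigfcupP[x /andP[xX _]]]; rewrite mem_nb => xy _.
rewrite (big_fsetD1 x) //= mulrDr ler_wpDr //.
  by rewrite mulr_ge0 ?sqr_ge0 // sumr_ge0.
rewrite /cnd /aker adj_sym xy mul1r expr2 mulrA mulfK ?gt_eqF //.
rewrite -hw_sq expr2 mulrCA ler_pM2l ?hw_gt0 //.
rewrite -hw_harmonic (big_fsetD1 y) ?mem_nb //= lerDl.
by apply: sumr_ge0 => z _; exact: sqrtr_ge0.
Qed.

Lemma w_amenableP : w_amenable R adj Gamma o <-> Phi = 0.
Proof.
pose S := [set (set_weight R Gamma o (outer_boundary adj F) / set_weight R Gamma o F)%E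
          | F in [set F | finite_set F /\ F !=set0]].
have SE X : X != fset0 -> S (wt (bdry X) / wt X)%:E.
  move=> X0; exists [set` X]; first by split; [exact: finite_fset | exact: set_fset_neq0].
  by rewrite outer_boundary_fset !set_weight_fset divEFin // gt_eqF // wt_gt0.
(* Real lower bounds of the infimum become inequalities between finite sums, comparable with those
   for [Phi]. *)
have SP (a : R) : (a%:E <= ereal_inf S)%E <-> forall X, a * wt X <= wt (bdry X).
  split => [h X|h].
    have [->|X0] := eqVneq X fset0.
      by rewrite [X in _ * X]big_seq_fset0 mulr0 sumr_ge0.
    rewrite -ler_pdivlMr ?wt_gt0 // -lee_fin; apply: le_trans h _.
    exact/ereal_inf_lbound/SE.
  apply: le_ereal_inf_tmp => _ [F [finF [x Fx]] <-].
  have XF := fset_setK finF; set X := fset_set F in XF.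
  have X0 : X != fset0.
    by apply/fset0Pn; exists x; rewrite /X in_fset_set // inE.
  rewrite -XF outer_boundary_fset !set_weight_fset divEFin ?gt_eqF ?wt_gt0 //.
  by rewrite lee_fin ler_pdivlMr ?wt_gt0.
rewrite /w_amenable -/S; split => [S0|Phi0].
  apply/le_anti; rewrite edge_expansion_ge0 andbT -lee_fin.
  rewrite [leRHS](_ : _ = ereal_inf S); last by rewrite S0.
  apply/SP => X; apply: le_trans (out_le_bdry X); exact: edge_expansion_le.
apply/eqP; rewrite eq_le; apply/andP; split; last first.
  by apply/SP => X; rewrite mul0r sumr_ge0.
rewrite leNgt; apply/negP => S0.
(* A real [a] is chosen because the infimum has not been shown finite; if it is infinite, [1] will
   do. *)
have [a a0 aS] : exists2 a : R, 0 < a & (a%:E <= ereal_inf S)%E.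
  case: (ereal_inf S) S0 => [r|_|//]; last by exists 1 => //; exact: leey.
  by rewrite lte_fin => r0; exists r.
have D0 : 0 < D by exact: walk_norm_gt0.
have aD : 0 < a / D ^+ 2 by rewrite divr_gt0 // exprn_gt0.
have : a / D ^+ 2 <= Phi.
  apply: edge_expansion_ge; first exact: ltW.
  move=> X; rewrite mulrAC ler_pdivrMr ?exprn_gt0 // mulrC.
  rewrite [leRHS]mulrC; apply: le_trans (bdry_le_out X); rewrite mulrC.
  by move/SP: aS; apply.
by rewrite Phi0 leNgt aD.
Qed.

(** * Bounds on the spectral radius *)

Variable x : V.

Let root n : R := nstep (2 * n) x x `^ (2 * n)%N%:R^-1.

Let rho : R := spectral_radius R adj Gamma o x.

Let s : R := Num.sqrt (1 - Phi ^+ 2).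

Lemma root_le n : (0 < n)%N -> root n <= s.
Proof.
move=> n0.
have s0 : 0 <= s by exact: sqrtr_ge0.
rewrite -(@root_expn R s (2 * n)) ?muln_gt0 //.
apply: ge0_ler_powR; rewrite ?nnegrE ?exprn_ge0 ?nstep_ge0 //.
apply: nstep_double_le; first exact: edge_expansion_ge0.
  exact: edge_expansion_lt1.
move=> F; have := edge_expansion_le F.
by rewrite outE -/(wt F); lra.
Qed.

Lemma root01 n : 0 <= root n <= 1.
Proof.
(* At [n = 0] the exponent [0^-1] is [0], so the root is [1]. *)
rewrite powR_ge0 /=; case: n => [|n]; first by rewrite /root muln0 invr0 powRr0.
apply: le_trans (root_le (ltn0Sn n)) _.
by rewrite -[leRHS]sqrtr1 ler_wsqrtr // gerBl sqr_ge0.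
Qed.

Lemma spectral_radius_le : rho <= s.
Proof. by apply: (@limn_sup_le _ root root01 s 1) => n n0; exact: root_le. Qed.

Lemma spectral_radius_ge0 : 0 <= rho.
Proof.
apply: (@limn_sup_ge _ root root01) => N; exists N => //.
by case/andP: (root01 N).
Qed.

(** Were the Rayleigh quotient [l] above [rho], then for [l'] midway between them [(l' / l)^(2n)]
    would eventually absorb the factor [#|F|] of [nstep_double_ge], forcing [rho >= l']. *)
Lemma spectral_radius_ge (F : {fset V}) :
  \sum_(a <- F) \sum_(b <- F) cnd a b <= rho * wt F.
Proof.
have [->|F0] := eqVneq F fset0; first by rewrite /wt !big_seq_fset0 mulr0.
rewrite -ler_pdivrMr ?wt_gt0 //.
set l := _ / _.
rewrite leNgt; apply/negP => rl.
pose l' : R := (rho + l) / 2.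
have rho0 := spectral_radius_ge0.
have l'0 : 0 < l' by rewrite /l'; lra.
have ll' : l' < l by rewrite /l'; lra.
suff : l' <= rho by rewrite /l'; lra.
apply: (@limn_sup_ge _ root root01) => N.
have l0 : 0 < l by exact: lt_trans ll'.
have m0 : 0 < #|` F|%:R :> R by rewrite ltr0n cardfs_gt0.
have r1 : `|l' / l| < 1.
  by rewrite normf_div (gtr0_norm l'0) (gtr0_norm l0) ltr_pdivrMr // mul1r.
have := cvg_expr r1 => /cvgr0_norm_lt /(_ #|` F|%:R^-1).
rewrite invr_gt0 => /(_ m0)[K _ hK].
(* [1] makes the root meaningful, [N] is asked for by the upper limit, and [K] makes the power
   small. *)
pose n := maxn 1 (maxn N K); exists n; first by rewrite /n; lia.
have n0 : (0 < n)%N by rewrite /n; lia.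
rewrite -(@root_expn R l' (2 * n)) ?muln_gt0 ?(ltW l'0) //.
apply: ge0_ler_powR; rewrite ?nnegrE ?exprn_ge0 ?nstep_ge0 ?(ltW l'0) //.
rewrite -(ler_pM2l m0); apply: le_trans (nstep_double_ge n x F0).
rewrite -/(wt F) -/l.
have : `|(l' / l) ^+ (2 * n)| < #|` F|%:R^-1 by apply: hK => /=; rewrite /n; lia.
rewrite normrX normf_div (gtr0_norm l'0) (gtr0_norm l0) expr_div_n => h.
by move/ltW: h; rewrite ler_pdivrMr ?exprn_gt0 // ler_pdivlMl.
Qed.

Lemma cheeger_bounds : [/\ 2^-1 * Phi ^+ 2 <= 1 - s, 1 - s <= 1 - rho, 1 - rho <= Phi &
  (rho = 1 <-> w_amenable R adj Gamma o)].
Proof.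
have Phi0 : 0 <= Phi by exact: edge_expansion_ge0.
have Phi1 : Phi ^+ 2 <= 1 by rewrite expr_le1 // ltW // edge_expansion_lt1.
have s0 : 0 <= s by exact: sqrtr_ge0.
have s2 : s ^+ 2 = 1 - Phi ^+ 2 by rewrite sqr_sqrtr // subr_ge0.
have rs := spectral_radius_le.
have rPhi : 1 - rho <= Phi.
  (* [edge_expansion_ge] wants a nonnegative constant; if [rho > 1] the claim follows from
     [Phi >= 0]. *)
  have [r1|r1] := leP rho 1; last by lra.
  apply: edge_expansion_ge => [|X]; first by rewrite subr_ge0.
  rewrite outE; have := spectral_radius_ge X.
  by lra.
(* Expanding [(1 - s)^2 >= 0] with [s^2 = 1 - Phi^2] gives the first inequality. *)
split => //; first by have := sqr_ge0 (1 - s); lra.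
  by lra.
rewrite w_amenableP; split => [r1|P0]; last first.
  apply/eqP; rewrite eq_le; apply/andP; split; last by lra.
  by apply: (le_trans rs); rewrite /s P0 expr0n /= subr0 sqrtr1.
(* If [rho = 1], then [rho <= s] forces [s >= 1], hence [Phi^2 <= 0]. *)
have s1 : 1 <= s by lra.
have : 1 <= s ^+ 2 by rewrite expr_ge1.
by rewrite s2 => h; apply/eqP; rewrite -sqrf_eq0 eq_le sqr_ge0 andbT; lra.
Qed.

End Walk.

Theorem theorem3p5 (R : realType) (V : choiceType) (adj : rel V)
    (Gamma : set (V -> V)) (o x : V)
    (Gsimple : simple_graph adj)
    (Gconn : connected_graph adj)
    (Glf : locally_finite_graph adj)
    (Gedge : exists y z : V, adj y z)
    (Gammagrp : aut_subgroup adj Gamma)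
    (Gammacl : closed_in_aut adj Gamma)
    (Gammatr : acts_transitively Gamma) :
  let Phi : R := edge_expansion R adj Gamma o in
  let rho : R := spectral_radius R adj Gamma o x in
  [/\ 2^-1 * Phi ^+ 2 <= 1 - Num.sqrt (1 - Phi ^+ 2),
      1 - Num.sqrt (1 - Phi ^+ 2) <= 1 - rho,
      1 - rho <= Phi &
      (rho = 1 <-> w_amenable R adj Gamma o)].
Proof. by case: Gsimple => adj_sym _; exact: cheeger_bounds. Qed.
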